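(* Let $p$ be a prime, $\tilde R=\mathrm{GR}(p^2,d)$ with $d\ge1$, $F=\tilde R/p\tilde R$. Let $$A'=\begin{bmatrix} B & C \\ D & E \end{bmatrix}\in\tilde R^{n\times n},\qquad B\in\tilde R^{a\times a},\quad B_0=B\bmod p\in F^{a\times a}\ \text{nonsingular},\quad k=n-a,$$ and assume $J=E-DB^{-1}C=pT$ with $T\in F^{k\times k}$. For $X\in F^{k\times t}$, consider the following oracle. (T1) Lift $X$ to any $\widetilde X\in\tilde R^{k\times t}$. (T2) Compute over $\tilde R$: $A'\begin{bmatrix} 0 \\ \widetilde X \end{bmatrix}=\begin{bmatrix} U \\ V \end{bmatrix}=\begin{bmatrix} C\widetilde X \\ E\widetilde X \end{bmatrix}$. (T3) Compute $Y\in\tilde R^{a\times t}$ with $BY=U$ by the Hensel solve: solve $B_0Y_0=U\bmod p$ over $F$, lift $Y_0$ to $\widetilde Y_0$ over $\tilde R$, put $W_1=(U-B\widetilde Y_0)/p\bmod p$, solve $B_0Y_1=W_1$ over $F$, lift $Y_1$ to $\widetilde Y_1$ over $\tilde R$, and set $Y=\widetilde Y_0+p\widetilde Y_1$. (T4) Compute over $\tilde R$: $Z=A'\begin{bmatrix} -Y \\ \widetilde X \end{bmatrix}$. (T5) Return $(\text{lower } k\times t \text{ block of } Z)/p\bmod p$. Then the oracle returns $TX$, where $T=J/p\bmod p$.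
   Context: $\mathrm{GR}(p^2,d)$ is the unramified Galois ring extension of $\mathbb{Z}/p^2\mathbb{Z}$ of degree $d$: a local ring with maximal ideal $p\tilde R$, $p^2=0$, residue field $F\cong\mathbb{F}_{p^d}$. Multiplication by $p$ induces an isomorphism $F=\tilde R/p\tilde R\to p\tilde R$, $\bar x\mapsto px$; for $z\in p\tilde R$, $z/p\bmod p$ denotes its preimage in $F$, and this is applied entrywise to matrices; $pT$ for $T$ over $F$ means applying the isomorphism entrywise. A lift of a matrix over $F$ is a matrix over $\tilde R$ reducing to it modulo $p$. *)

(* Defs.v *)
From HB Require Import structures.
From mathcomp Require Import all_boot all_order all_algebra.

Set Implicit Arguments.
Unset Strict Implicit.
Unset Printing Implicit Defensive.

Import GRing.Theory.
Local Open Scope ring_scope.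
Local Open Scope quotient_scope.

Definition Zp2_to_Fp (p : nat) (x : 'Z_(p ^ 2)) : 'F_p := (x : nat)%:R.

(* GR(p^2, d) is (Z/p^2)[x]/(f), where f is monic of degree d and irreducible
   modulo p; the structure holds of every ring isomorphic to such a quotient.
   Finiteness is part of the carrier so that p R is a decidable ideal. *)
HB.mixin Record isGaloisRing (p d : nat) R of FinRing.ComUnitRing R := {
  galois_prime : prime p;
  galois_presentation : exists f : {poly 'Z_(p ^ 2)},
    [/\ f \is monic, size f = d.+1,
        irreducible_poly (map_poly (@Zp2_to_Fp p) f)
      & exists phi : {rmorphism {poly %/ f} -> R}, bijective phi]
}.

#[short(type="galoisRingType")]
HB.structure Definition GaloisRing (p d : nat) :=
  {R of FinRing.ComUnitRing R & isGaloisRing p d R}.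

Section Zp2ToFp.

Variables (p : nat) (p_pr : prime p).
Local Notation red := (@Zp2_to_Fp p).

Lemma Zp2_gt1 : (1 < p ^ 2)%N.
Proof. by rewrite -[1%N](expn0 p) ltn_exp2l ?prime_gt1. Qed.

Lemma Zp2_to_Fp_nat n : red n%:R = n%:R.
Proof.
rewrite /Zp2_to_Fp val_Zp_nat ?Zp2_gt1 // [in RHS](divn_eq n (p ^ 2)) natrD.
by rewrite expnS mulnCA natrM (pchar_Fp_0 p_pr) mul0r add0r.
Qed.

Lemma Zp2_to_Fp_is_zmod_morphism : zmod_morphism red.
Proof.
have redD u v : red (u + v) = red u + red v.
  have -> : u + v = (u + v)%N%:R by rewrite natrD !natr_Zp.
  by rewrite Zp2_to_Fp_nat natrD.
by move=> x y; apply/(canRL (addrK _)); rewrite -redD subrK.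
Qed.

Lemma Zp2_to_Fp_is_monoid_morphism : monoid_morphism red.
Proof.
split=> [|x y]; first exact: (Zp2_to_Fp_nat 1).
have -> : x * y = (x * y)%N%:R by rewrite natrM !natr_Zp.
by rewrite Zp2_to_Fp_nat natrM.
Qed.

Lemma map_Zp2_to_FpD : {morph map_poly red : f g / f + g}.
Proof.
pose a := GRing.isZmodMorphism.Build _ _ red Zp2_to_Fp_is_zmod_morphism.
pose r : {additive _ -> _} := HB.pack red a.
exact: (raddfD (map_poly r)).
Qed.

Lemma map_Zp2_to_FpM : {morph map_poly red : f g / f * g}.
Proof.
pose a := GRing.isZmodMorphism.Build _ _ red Zp2_to_Fp_is_zmod_morphism.
pose m := GRing.isMonoidMorphism.Build _ _ red Zp2_to_Fp_is_monoid_morphism.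
pose r : {rmorphism _ -> _} := HB.pack red a m.
exact: (rmorphM (map_poly r)).
Qed.

Lemma Zp2_to_Fp0 : red 0 = 0. Proof. exact: (Zp2_to_Fp_nat 0). Qed.
Lemma Zp2_to_Fp1 : red 1 = 1. Proof. exact: (Zp2_to_Fp_nat 1). Qed.

Lemma map_Zp2_to_Fp_surj (q : {poly 'F_p}) : exists f, map_poly red f = q.
Proof.
exists (\poly_(i < size q) (nat_of_ord (q`_i)%R)%:R); apply/polyP=> i.
rewrite coef_map_id0 ?Zp2_to_Fp0 // coef_poly.
by case: ltnP => [_|?]; rewrite ?Zp2_to_Fp_nat ?natr_Zp // nth_default
  ?Zp2_to_Fp0.
Qed.

Lemma map_Zp2_to_Fp_eq0 (f : {poly 'Z_(p ^ 2)}) :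
  map_poly red f = 0 -> exists g, f = p%:R * g.
Proof.
move=> f0; exists (\poly_(i < size f) (nat_of_ord (f`_i)%R %/ p)%N%:R).
apply/polyP=> i; rewrite -polyC_natr coefCM coef_poly.
case: ltnP => [_|?]; last by rewrite mulr0 nth_default.
have /(congr1 val) : red f`_i = 0.
  by rewrite -coef_map_id0 ?Zp2_to_Fp0 // f0 coef0.
rewrite /Zp2_to_Fp /= val_Fp_nat // => /eqP dvd_p.
by rewrite -natrM mulnC divnK // natr_Zp.
Qed.

End Zp2ToFp.

Section ResidueField.

Variables (p d : nat) (R : galoisRingType p d).

Let p_pr : prime p := galois_prime (s := R).

Definition pideal : pred R := fun z => [exists y, z == p%:R * y].

Lemma pidealP z : reflect (exists y, z = p%:R * y) (z \in pideal).
Proof. by apply: (iffP existsP) => -[y /eqP]; exists y => //; apply/eqP. Qed.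

Lemma galois_natr_eq0 n : ((n%:R : R) == 0) = (p ^ 2 %| n)%N.
Proof.
have [f [_ _ _ [phi /bij_inj phi_inj]]] := galois_presentation (s := R).
rewrite -(rmorph_nat phi) -(rmorph0 phi) (inj_eq phi_inj).
rewrite -val_eqE /= qpolyC_natr -polyC_natr polyC_eq0.
by rewrite -val_eqE /= val_Zp_nat ?Zp2_gt1.
Qed.

Lemma galois_p_neq0 : p%:R != 0 :> R.
Proof.
rewrite galois_natr_eq0; apply/negP => /dvdn_leq-/(_ (prime_gt0 p_pr)).
by rewrite -mulnn -{3}[p]mul1n leq_pmul2r ?prime_gt0 // leqNgt prime_gt1.
Qed.

Lemma galois_p2 : p%:R * p%:R = 0 :> R.
Proof. by apply/eqP; rewrite -natrM mulnn galois_natr_eq0. Qed.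

Lemma pideal_closed : idealr_closed pideal.
Proof.
split; first by apply/pidealP; exists 0; rewrite mulr0.
  apply/pidealP => -[y]; move/(congr1 ( *%R p%:R)) => /eqP.
  by rewrite mulrA galois_p2 mul0r mulr1 (negPf galois_p_neq0).
move=> a u v /pidealP[x ->] /pidealP[y ->]; apply/pidealP.
by exists (a * x + y); rewrite mulrDr mulrCA.
Qed.

HB.instance Definition _ := isIdealr.Build R pideal pideal_closed.

Lemma pideal_unit x : x \notin pideal -> x \is a GRing.unit.
Proof.
move=> xNp; have [f [fm sf firr [phi [psi phiK psiK]]]] :=
  galois_presentation (s := R).
have mf : mk_monic f = f.
  have := firr.1; rewrite size_map_poly_id0 ?(monicP fm) ?Zp2_to_Fp1 //.
  by rewrite /mk_monic fm => ->.
have sred : size (map_poly (@Zp2_to_Fp p) f) = size f.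
  by rewrite size_map_poly_id0 // (monicP fm) Zp2_to_Fp1 ?oner_eq0.
pose g : {poly 'Z_(p ^ 2)} := psi x.
have xE : x = phi (in_qpoly f g).
  rewrite -[LHS]psiK; congr (phi _); apply/val_inj.
  by rewrite [RHS]in_qpoly_small // size_mk_monic.
have cop : coprimep (map_poly (@Zp2_to_Fp p) f) (map_poly (@Zp2_to_Fp p) g).
  rewrite irreducible_poly_coprime //; apply: contra xNp => dvd_fg.
  have [h gE] : exists h, g = p%:R * h.
    apply: map_Zp2_to_Fp_eq0 => //; apply/eqP; apply: contraTT dvd_fg => g0.
    apply/negP => /dvdp_leq-/(_ g0); rewrite sred leqNgt => /negP; apply.
    apply: (@leq_ltn_trans (size g)); first exact: size_poly.
    by apply: (leq_trans (size_mk_monic (psi x))); rewrite mf.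
  apply/pidealP; exists (phi (in_qpoly f h)).
  by rewrite xE gE !rmorphM !rmorph_nat.
have /Bezout_eq1_coprimepP [[u v] /= uv1] := cop.
have [U uE] := map_Zp2_to_Fp_surj p_pr u.
have [V vE] := map_Zp2_to_Fp_surj p_pr v.
have [h hE] : exists h, U * f + V * g - 1 = p%:R * h.
  apply: map_Zp2_to_Fp_eq0 => //; apply: (addIr 1).
  have one : map_poly (@Zp2_to_Fp p) 1 = 1.
    apply/polyP=> i; rewrite coef_map_id0 ?Zp2_to_Fp0 // !coef1.
    by case: (i == 0)%N; rewrite ?Zp2_to_Fp1 ?Zp2_to_Fp0.
  rewrite add0r -[X in _ + X = _]one -map_Zp2_to_FpD // subrK.
  by rewrite map_Zp2_to_FpD // !map_Zp2_to_FpM // uE vE.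
have f0 : in_qpoly f f = 0.
  by apply/val_inj; rewrite /= mf Pdiv.RingMonic.rmodpp.
pose r : {rmorphism {poly 'Z_(p ^ 2)} -> R} := phi \o in_qpoly f.
have rf : r f = 0 by rewrite /r /= f0 rmorph0.
have rg : r g = x by [].
pose y := r V; pose z := r h.
have yx : y * x = 1 + p%:R * z.
  have /eqP := congr1 r hE; rewrite rmorphB rmorphD !rmorphM rf mulr0 add0r rg.
  by rewrite rmorph1 rmorph_nat subr_eq addrC => /eqP.
apply/unitrP; exists ((1 - p%:R * z) * y); rewrite [x * _]mulrC.
suff -> : (1 - p%:R * z) * y * x = 1 by [].
rewrite -mulrA yx mulrDr mulr1 mulrBl mul1r mulrACA galois_p2 mul0r subr0.
by rewrite subrK.
Qed.

Definition residue_field : Type := {ideal_quot (pideal : idealr R)}.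
HB.instance Definition _ := GRing.ComNzRing.on residue_field.
HB.instance Definition _ := NzRingQuotient.on residue_field.

Definition mod_p (x : R) : residue_field := \pi_residue_field x.
HB.instance Definition _ :=
  GRing.RMorphism.copy mod_p (\pi_residue_field : R -> residue_field).

Lemma mod_p_repr (x : residue_field) : mod_p (repr x) = x.
Proof. exact: reprK. Qed.

Lemma mod_p_eq x y : (mod_p x == mod_p y) = (x - y \in pideal).
Proof. by rewrite Quotient.idealrBE. Qed.

Lemma mod_p_eq0 x : (mod_p x == 0) = (x \in pideal).
Proof. by rewrite -(rmorph0 mod_p) mod_p_eq subr0. Qed.

Definition residue_inv (x : residue_field) : residue_field :=
  if x == 0 then 0 else mod_p (repr x)^-1.

Lemma residue_mulVx x : x != 0 -> residue_inv x * x = 1.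
Proof.
rewrite /residue_inv => x0; rewrite (negPf x0) -{2}(mod_p_repr x) -rmorphM.
by rewrite mulVr ?rmorph1 // pideal_unit // -mod_p_eq0 mod_p_repr.
Qed.

Lemma residue_inv0 : residue_inv 0 = 0.
Proof. by rewrite /residue_inv eqxx. Qed.

HB.instance Definition _ :=
  GRing.ComNzRing_isField.Build residue_field residue_mulVx residue_inv0.

Definition mul_p (x : residue_field) : R := p%:R * repr x.

Lemma mul_p_mod_p x : mul_p (mod_p x) = p%:R * x.
Proof.
rewrite /mul_p; apply/eqP; rewrite -subr_eq0 -mulrBr.
have : repr (mod_p x) - x \in pideal by rewrite -mod_p_eq mod_p_repr.
by move=> /pidealP[y ->]; rewrite mulrA galois_p2 mul0r.
Qed.

(* div_p is meaningful only on p R. *)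
Definition div_p (z : R) : residue_field :=
  if [pick y | z == p%:R * y] is Some y then mod_p y else 0.

Lemma mul_pK : cancel mul_p div_p.
Proof.
move=> x; rewrite /div_p; case: pickP => [y /eqP e|/(_ (repr x))]; last first.
  by rewrite eqxx.
apply/eqP; rewrite -[x]mod_p_repr mod_p_eq; apply: contraT => /pideal_unit u.
have /eqP : p%:R * (y - repr x) = 0 by rewrite mulrBr -e subrr.
rewrite -(mul0r (y - repr x)) (inj_eq (mulIr u)).
by rewrite (negPf galois_p_neq0).
Qed.

Lemma div_pK : {in pideal, cancel div_p mul_p}.
Proof. by move=> _ /pidealP[y ->]; rewrite -mul_p_mod_p mul_pK. Qed.

(* None when some entry is not divisible by p. *)
Definition mx_div_p m n (M : 'M[R]_(m, n)) : option 'M[residue_field]_(m, n) :=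
  if [forall i, forall j, M i j \in pideal] then Some (map_mx div_p M)
  else None.

End ResidueField.

Section Oracle.

Variables (p d : nat) (R : galoisRingType p d).
Local Notation F := (residue_field R).
Local Notation mx_mod_p := (map_mx (@mod_p p d R)).

Definition is_mx_lift m n (lift : 'M[F]_(m, n) -> 'M[R]_(m, n)) : Prop :=
  forall M, mx_mod_p (lift M) = M.

(* The lifts chosen by the algorithm are arbitrary: each lifting step takes its
   own lifting function as a parameter. *)
Definition hensel_solve a t (lift0 lift1 : 'M[F]_(a, t) -> 'M[R]_(a, t))
    (B : 'M[R]_a) (U : 'M[R]_(a, t)) : option 'M[R]_(a, t) :=
  let B0 := mx_mod_p B in
  let Y0 := invmx B0 *m mx_mod_p U in
  let Yt0 := lift0 Y0 in
  obind (fun W1 =>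
    let Y1 := invmx B0 *m W1 in
    let Yt1 := lift1 Y1 in
    Some (Yt0 + p%:R *: Yt1)) (mx_div_p (U - B *m Yt0)).

Definition tangent_oracle a k t
    (liftX : 'M[F]_(k, t) -> 'M[R]_(k, t))
    (lift0 lift1 : 'M[F]_(a, t) -> 'M[R]_(a, t))
    (A : 'M[R]_(a + k)) (X : 'M[F]_(k, t)) : option 'M[F]_(k, t) :=
  let Xt := liftX X in
  let U := usubmx (A *m col_mx 0 Xt) in
  obind (fun Y => mx_div_p (dsubmx (A *m col_mx (- Y) Xt)))
    (hensel_solve lift0 lift1 (ulsubmx A) U).

End Oracle.

(* Main.v *)
Require Import Defs.
From mathcomp Require Import all_boot all_order all_algebra.
Import GRing.Theory.
Local Open Scope ring_scope.

(** Since [B] is invertible over the local ring, the Hensel solve must return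
    [Y = B^-1 C Xt], so the lower block of [A' (-Y, Xt)] is the Schur complement
    applied to [Xt]: [(E - D B^-1 C) Xt = (p T) Xt = p (T X)].  Both the solve and
    the last equality rest on the fact that [p M] only depends on [M mod p]. *)

Section MatrixReduction.

Set Implicit Arguments.
Unset Strict Implicit.

Variables (p d : nat) (R : galoisRingType p d).
Local Notation F := (residue_field R).
Local Notation mx_mod_p := (map_mx (@mod_p p d R)).
Local Notation mx_mul_p := (map_mx (@mul_p p d R)).

Lemma mul_p_in_pideal (x : F) : mul_p x \in pideal (R := R).
Proof. by apply/pidealP; exists (repr x). Qed.

(** Locality: every element outside [pideal] is a unit, so a nonzero residue can only come from a
    unit. *)
Lemma unitr_mod_p (x : R) : (mod_p x \is a GRing.unit) = (x \is a GRing.unit).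
Proof.
apply/idP/idP => [|xU]; last exact: rmorph_unit.
by rewrite unitfE mod_p_eq0; apply: pideal_unit.
Qed.

Lemma unitmx_mod_p n (M : 'M[R]_n) : (mx_mod_p M \in unitmx) = (M \in unitmx).
Proof. by rewrite !unitmxE det_map_mx unitr_mod_p. Qed.

Lemma mx_mul_p_mod_p m n (M : 'M[R]_(m, n)) :
  mx_mul_p (mx_mod_p M) = p%:R *: M.
Proof. by apply/matrixP => i j; rewrite !mxE mul_p_mod_p. Qed.

Lemma mx_mod_p_surj m n (M : 'M[F]_(m, n)) : exists N, mx_mod_p N = M.
Proof.
by exists (map_mx repr M); apply/matrixP => i j; rewrite !mxE mod_p_repr.
Qed.

Lemma mx_mod_p_eq0 m n (M : 'M[R]_(m, n)) :
  mx_mod_p M = 0 -> exists N, M = mx_mul_p N.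
Proof.
(* [div_p] has a junk value off [pideal]; the vanishing of each residue is what lets [div_pK]
   apply. *)
move=> M0; exists (map_mx (@div_p p d R) M); apply/matrixP => i j.
have /matrixP/(_ i j)/eqP := M0; rewrite !mxE mod_p_eq0 => Mp.
by rewrite div_pK.
Qed.

Lemma mx_mul_pK m n (M : 'M[F]_(m, n)) : mx_div_p (mx_mul_p M) = Some M.
Proof.
rewrite /mx_div_p ifT; last first.
  by apply/forallP => i; apply/forallP => j; rewrite mxE mul_p_in_pideal.
by congr Some; apply/matrixP => i j; rewrite !mxE mul_pK.
Qed.

(** For any lift [M'] of [M], both sides equal [p M' N]. *)
Lemma mulmx_mul_pl m n q (M : 'M[F]_(m, n)) (N : 'M[R]_(n, q)) :
  mx_mul_p M *m N = mx_mul_p (M *m mx_mod_p N).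
Proof.
have [M' <-] := mx_mod_p_surj M.
by rewrite -map_mxM !mx_mul_p_mod_p scalemxAl.
Qed.

(** One correction suffices since [p^2 = 0]: the residual of the first approximation is some [p W],
    and the correction contributes exactly [p W]. *)
Lemma hensel_solveP a t (lift0 lift1 : 'M[F]_(a, t) -> 'M[R]_(a, t))
    (B : 'M[R]_a) (U : 'M[R]_(a, t)) :
    is_mx_lift lift0 -> is_mx_lift lift1 -> mx_mod_p B \in unitmx ->
  exists2 Y, hensel_solve lift0 lift1 B U = Some Y & B *m Y = U.
Proof.
move=> lift0P lift1P B0U; rewrite /hensel_solve.
set Y0 := lift0 _.
have [W resE] : exists W, U - B *m Y0 = mx_mul_p W.
  by apply: mx_mod_p_eq0; rewrite map_mxB map_mxM lift0P mulKVmx ?subrr.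
rewrite resE mx_mul_pK /=; eexists; first by [].
(* [p (B Yt1)] is fixed by the residue of [B Yt1], which is [B0 Y1 = W] for any lift of [Y1]. *)
rewrite mulmxDr -scalemxAr -mx_mul_p_mod_p map_mxM lift1P mulKVmx //.
by rewrite -resE addrC subrK.
Qed.

End MatrixReduction.

Theorem lemma6p2 (p d : nat) (p_pr : prime p) (d_ge1 : (1 <= d)%N)
  (R : galoisRingType p d) (a k t : nat)
  (B : 'M[R]_a) (C : 'M[R]_(a, k)) (D : 'M[R]_(k, a)) (E : 'M[R]_k)
  (B0_nonsingular : map_mx (@mod_p p d R) B \in unitmx)
  (T : 'M[residue_field R]_k)
  (J_pT : E - D *m invmx B *m C = map_mx (@mul_p p d R) T)
  (X : 'M[residue_field R]_(k, t))
  (liftX : 'M[residue_field R]_(k, t) -> 'M[R]_(k, t))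
  (lift0 lift1 : 'M[residue_field R]_(a, t) -> 'M[R]_(a, t))
  (liftXP : is_mx_lift liftX)
  (lift0P : is_mx_lift lift0) (lift1P : is_mx_lift lift1) :
  let A' := block_mx B C D E in
  let Xt := liftX X in
  [/\ A' *m col_mx 0 Xt = col_mx (C *m Xt) (E *m Xt),
      exists2 Y, hensel_solve lift0 lift1 B (C *m Xt) = Some Y
               & B *m Y = C *m Xt,
      mx_div_p (E - D *m invmx B *m C) = Some T
    & tangent_oracle liftX lift0 lift1 A' X = Some (T *m X)].
Proof.
move=> A' Xt.
have A'X : A' *m col_mx 0 Xt = col_mx (C *m Xt) (E *m Xt).
  by rewrite mul_block_col !mulmx0 !add0r.
have [Y solveE BY] :=
  hensel_solveP (C *m Xt) lift0P lift1P B0_nonsingular.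
split=> //; first by exists Y.
  by rewrite J_pT mx_mul_pK.
(* [B] is a unit because its reduction is, so the solution is unique and the choice of lifts is
   immaterial. *)
have YE : Y = invmx B *m C *m Xt.
  by rewrite -mulmxA -BY mulKmx // -unitmx_mod_p.
rewrite /tangent_oracle A'X col_mxKu block_mxKul solveE /=.
(* The lower block [- D Y + E Xt] factors as [(E - D B^-1 C) Xt]. *)
rewrite mul_block_col col_mxKd YE mulmxN addrC !mulmxA -mulmxBl J_pT.
by rewrite mulmx_mul_pl liftXP mx_mul_pK.
Qed.
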